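(* Let $\mathbf L$ be a nontrivial $\mathrm e$-cyclic residuated lattice and let $P$ be a prime convex subalgebra of $\mathbf L$. The following statements are equivalent: (1) $P$ is a minimal prime convex subalgebra of $\mathbf L$; (2) for all $x\in L$, $x\in P$ implies $x^\perp\not\subseteq P$; (3) $P=\bigcup\{x^\perp: x\in L\setminus P\}$.
   Context: A residuated lattice is an algebra $\mathbf L=(L,\cdot,\backslash,/,\vee,\wedge,\mathrm e)$ such that $(L,\cdot,\mathrm e)$ is a monoid, $(L,\vee,\wedge)$ is a lattice with order $\le$, and $x\cdot y\le z \iff y\le x\backslash z \iff x\le z/y$ for all $x,y,z\in L$. It is $\mathrm e$-cyclic if $\mathrm e/x=x\backslash \mathrm e$ for all $x\in L$, and nontrivial if $L\neq\{\mathrm e\}$. The absolute value of $x\in L$ is $|x|=x\wedge(\mathrm e/x)\wedge \mathrm e$. A convex subalgebra of $\mathbf L$ is a subalgebra (closed under all operations, containing $\mathrm e$) whose universe is order-convex. $\mathcal C(\mathbf L)$ is the lattice of convex subalgebras ordered by inclusion. $P\in\mathcal C(\mathbf L)$ is prime if whenever $X,Y\in\mathcal C(\mathbf L)$ and $X\cap Y\subseteq P$, then $X\subseteq P$ or $Y\subseteq P$. A minimal prime convex subalgebra is a minimal element, under inclusion, of the set of prime convex subalgebras. The principal polar of $x\in L$ is $x^\perp=\{a\in L: |a|\vee|x|=\mathrm e\}$, which is a convex subalgebra of $\mathbf L$. *)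

(* Defs.v *)
From HB Require Import structures.
From mathcomp Require Import all_boot all_order.
From mathcomp Require Import all_classical.

Set Implicit Arguments.
Unset Strict Implicit.
Unset Printing Implicit Defensive.

Local Open Scope classical_set_scope.
Local Open Scope order_scope.
Local Open Scope group_scope.

(* [ldiv x z] is x \ z and [rdiv z y] is z / y, so the denominator is the
   first argument of [ldiv] and the second argument of [rdiv]. *)
HB.mixin Record isResiduated d L of Order.Lattice d L & monoid.Monoid L := {
  ldiv : L -> L -> L;
  rdiv : L -> L -> L;
  ldivP : forall x y z : L, (x * y <= z) = (y <= ldiv x z);
  rdivP : forall x y z : L, (x * y <= z) = (x <= rdiv z y)
}.

#[short(type="residuatedLatticeType")]
HB.structure Definition ResiduatedLattice d :=
  { L of isResiduated d L & Order.Lattice d L & monoid.Monoid L }.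

Section ResiduatedLatticeDefs.
Context {d : Order.disp_t} {L : residuatedLatticeType d}.
Implicit Types (x y : L) (C P : set L).

Definition absval x : L := x `&` rdiv 1 x `&` 1.

Record convex_subalgebra C : Prop := ConvexSubalgebra {
  convex_sub1 : C 1;
  convex_subM : forall x y, C x -> C y -> C (x * y);
  convex_sub_ldiv : forall x y, C x -> C y -> C (ldiv x y);
  convex_sub_rdiv : forall x y, C x -> C y -> C (rdiv x y);
  convex_sub_join : forall x y, C x -> C y -> C (x `|` y);
  convex_sub_meet : forall x y, C x -> C y -> C (x `&` y);
  convex_sub_convex : forall x y z, C x -> C z -> x <= y -> y <= z -> C y
}.

(* The improper subalgebra [setT] counts as prime. *)
Definition prime_convex P : Prop :=
  convex_subalgebra P /\
  forall X Y : set L, convex_subalgebra X -> convex_subalgebra Y ->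
    (X `&` Y `<=` P)%classic -> (X `<=` P)%classic \/ (Y `<=` P)%classic.

Definition minimal_prime_convex P : Prop :=
  prime_convex P /\
  forall Q : set L, prime_convex Q -> (Q `<=` P)%classic -> Q = P.

Definition polar x : set L := [set a : L | absval a `|` absval x = 1].

End ResiduatedLatticeDefs.

Definition nontrivial {d : Order.disp_t} (L : residuatedLatticeType d) : Prop :=
  exists x : L, x <> 1.

Definition e_cyclic {d : Order.disp_t} (L : residuatedLatticeType d) : Prop :=
  forall x : L, rdiv 1 x = ldiv x 1.

(* Main.v *)
(* Write N for the negative cone {x : x <= 1}.  A convex subalgebra is determined
   by its trace on N, a multiplicative filter, and it is prime when the
   complement of this trace in N is closed under joins.  The key inequality is
   (a \/ c)(b \/ c) <= ab \/ c in N: it shows that a filter containing all joins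
   s \/ t, for s in S and t in T, contains all joins of elements of the filters
   generated by S and by T.  Hence a filter maximal among those missing a given
   join-closed set is prime.  If P is a minimal prime, x is in P and x^perp is
   contained in P, then the join-closed set {d \/ |x| : d in N \ P} misses 1, and
   a prime missing it lies strictly below P; when P is the whole algebra this
   set is empty, and a prime missing some |c| <> 1 is used instead. *)
Require Import Defs.
From mathcomp Require Import all_boot all_order.
From mathcomp Require Import all_classical.

Local Open Scope classical_set_scope.

Import Order.TTheory.

Section NegativeCone.
Local Open Scope order_scope.
Local Open Scope group_scope.
Context {d : Order.disp_t} {L : residuatedLatticeType d}.
Implicit Types (a b c h k x y z : L) (C F J P S T : set L).

(** * Order, products and absolute values *)

Lemma res_lemul2l z x y : x <= y -> z * x <= z * y.
Proof. by move=> xy; rewrite ldivP (le_trans xy)// -ldivP. Qed.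

Lemma res_lemul2r z x y : x <= y -> x * z <= y * z.
Proof. by move=> xy; rewrite rdivP (le_trans xy)// -rdivP. Qed.

Lemma res_lemul x y z t : x <= y -> z <= t -> x * z <= y * t.
Proof. by move=> xy zt; exact: le_trans (res_lemul2r _ _ _ xy) (res_lemul2l _ _ _ zt). Qed.

Lemma mul_le_l x y : y <= 1 -> x * y <= x.
Proof. by move=> /(res_lemul2l x); rewrite mulg1. Qed.

Lemma mul_le_r x y : x <= 1 -> x * y <= y.
Proof. by move=> /(res_lemul2r y); rewrite mul1g. Qed.

Lemma mul_joinr x y z : x * (y `|` z) = x * y `|` x * z.
Proof.
apply/le_anti/andP; split; first by rewrite ldivP leUx -!ldivP leUl leUr.
by rewrite leUx !res_lemul2l// ?leUl ?leUr.
Qed.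

Lemma mul_joinl x y z : (y `|` z) * x = y * x `|` z * x.
Proof.
apply/le_anti/andP; split; first by rewrite rdivP leUx -!rdivP leUl leUr.
by rewrite leUx !res_lemul2r// ?leUl ?leUr.
Qed.

(** Distributing leaves [a * b] and three products with a factor [c], each below [c] since the other
    factor is at most 1. *)
Lemma mul_join_le a b c : a <= 1 -> b <= 1 -> c <= 1 ->
  (a `|` c) * (b `|` c) <= a * b `|` c.
Proof.
move=> a1 b1 c1; rewrite mul_joinl !mul_joinr !leUx leUl/=.
by rewrite !lexU2 ?mul_le_l ?mul_le_r// orbT.
Qed.

Lemma absval_le x : absval x <= x.
Proof. by rewrite /absval !leIxl. Qed.

Lemma absval_le1 x : absval x <= 1.
Proof. by rewrite /absval leIr. Qed.

Lemma absval_mul_le1 x : absval x * x <= 1.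
Proof. by rewrite rdivP /absval leIxl// leIxr. Qed.

(** With the bounds above, [absval x] is the greatest [h <= 1] satisfying [h <= x] and
    [h * x <= 1]. *)
Lemma le_absval h x : h <= 1 -> h <= x -> h * x <= 1 -> h <= absval x.
Proof. by rewrite rdivP /absval !lexI => -> -> ->. Qed.

Lemma absval_eq1 x : absval x = 1 -> x = 1.
Proof.
move=> x1; apply/le_anti/andP; split; last by rewrite -x1 absval_le.
by have := absval_mul_le1 x; rewrite x1 mul1g.
Qed.

Lemma absval_id x : x <= 1 -> absval x = x.
Proof.
move=> x1; apply/le_anti; rewrite absval_le le_absval//.
by rewrite (le_trans (mul_le_l _ _ x1)).
Qed.

Lemma absval_join_le1 a b : absval a `|` absval b <= 1.
Proof. by rewrite leUx !absval_le1. Qed.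

(** * Filters of the negative cone *)

Record neg_filter F : Prop := NegFilter {
  neg_filter_le1 : forall x, F x -> x <= 1;
  neg_filterM : forall x y, F x -> F y -> F (x * y);
  neg_filter_up : forall x y, F x -> x <= y -> y <= 1 -> F y
}.

Inductive filter_gen S : set L :=
| FilterGenIn s of S s : filter_gen S s
| FilterGenM x y of filter_gen S x & filter_gen S y : filter_gen S (x * y)
| FilterGenUp x y of filter_gen S x & x <= y & y <= 1 : filter_gen S y.

Lemma neg_filter_gen S : (forall s, S s -> s <= 1) -> neg_filter (filter_gen S).
Proof.
move=> S1; split; [|exact: FilterGenM|exact: FilterGenUp].
move=> x; elim=> [s /S1//|a b _ a1 _ b1|//].
by rewrite (le_trans (mul_le_l _ _ b1)).
Qed.

(** For fixed [c <= 1], the negative elements whose join with [c] lies in [F] are closed under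
    products by [mul_join_le]. This is used in one variable at a time. *)
Lemma filter_gen_join F S T : neg_filter F ->
    (forall s, S s -> s <= 1) -> (forall t, T t -> t <= 1) ->
    (forall s t, S s -> T t -> F (s `|` t)) ->
  forall u v, filter_gen S u -> filter_gen T v -> F (u `|` v).
Proof.
move=> Ff S1 T1 ST.
have gS1 := neg_filter_le1 _ (neg_filter_gen _ S1).
have gT1 := neg_filter_le1 _ (neg_filter_gen _ T1).
have aux R (gR1 : forall x, filter_gen R x -> x <= 1) c :
    c <= 1 -> (forall r, R r -> F (r `|` c)) ->
    forall r, filter_gen R r -> F (r `|` c).
  move=> c1 Rc r; elim=> [//|x y Rx Fx Ry Fy|x y _ Fx xy y1].
    apply: (neg_filter_up _ Ff _ _ (neg_filterM _ Ff _ _ Fx Fy)).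
      by apply: mul_join_le => //; exact: gR1.
    by rewrite leUx c1 (le_trans (mul_le_l _ _ _)) ?gR1.
  by apply: (neg_filter_up _ Ff _ _ Fx); rewrite ?leU2// leUx y1.
move=> u v Su Tv; apply: (aux S) Su => //; first exact: gT1.
move=> s Ss; rewrite joinC; apply: (aux T) Tv => //; first exact: S1.
by move=> t Tt; rewrite joinC; exact: ST.
Qed.

(** * Passing between convex subalgebras and filters *)

Lemma convex_sub_absval C x : convex_subalgebra C -> C x -> C (absval x).
Proof.
move=> CC Cx; have C1 := convex_sub1 CC.
by do 2!apply: (convex_sub_meet CC) => //; exact: (convex_sub_rdiv CC).
Qed.

Lemma convex_sub_filter C : convex_subalgebra C ->
  neg_filter [set x | C x /\ x <= 1].
Proof.
move=> CC; split=> [x []//|x y [Cx x1] [Cy y1]|x y [Cx _] xy y1] /=.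
  split; first exact: (convex_subM CC).
  by rewrite (le_trans (mul_le_l _ _ y1)).
by split=> //; exact: (convex_sub_convex CC Cx (convex_sub1 CC)).
Qed.

(** The condition puts [x] between [h] and [ldiv h 1]. For a filter it amounts to [F (absval x)],
    but a free bound [h] spares computing absolute values of compound terms. *)
Definition convex_hull F : set L :=
  [set x | exists2 h, F h & h <= x /\ h * x <= 1].

Lemma absval_convex_hull F x : neg_filter F -> convex_hull F x -> F (absval x).
Proof.
move=> Ff [h Fh [hx hx1]]; apply: (neg_filter_up _ Ff _ _ Fh) (absval_le1 x).
by rewrite le_absval// (neg_filter_le1 _ Ff).
Qed.

Lemma convex_hull_absval F x : F (absval x) -> convex_hull F x.
Proof.
by move=> Fx; exists (absval x) => //; rewrite absval_le absval_mul_le1.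
Qed.

Lemma sub_convex_hull F x : neg_filter F -> F x -> convex_hull F x.
Proof.
move=> Ff Fx; exists x => //; split=> //.
have x1 := neg_filter_le1 _ Ff _ Fx.
by rewrite (le_trans (mul_le_l _ _ x1)).
Qed.

Lemma convex_hull_le1 F x : neg_filter F -> convex_hull F x -> x <= 1 -> F x.
Proof.
move=> Ff [h Fh [hx _]]; exact: (neg_filter_up _ Ff _ _ Fh hx).
Qed.

Section Cyclic.
Hypothesis L_cyclic : e_cyclic L.

(** The form in which e-cyclicity enters: it serves the closure of hulls under the two divisions. *)
Lemma cyclic_le1 x y : (x * y <= 1) = (y * x <= 1).
Proof. by rewrite rdivP L_cyclic -ldivP. Qed.

Lemma convex_subalgebra_absval C x : convex_subalgebra C ->
  C (absval x) -> C x.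
Proof.
move=> CC Cx; apply: (convex_sub_convex CC Cx _ (absval_le x)).
  exact: (convex_sub_ldiv CC Cx (convex_sub1 CC)).
by rewrite -ldivP absval_mul_le1.
Qed.

(* The bound h k k h lies below both h k and k h, which is what each of the
   closure conditions needs of the bounds h of x and k of y. *)
Lemma convex_hull_subalgebra F : neg_filter F -> F 1 ->
  convex_subalgebra (convex_hull F).
Proof.
move=> Ff F1.
have bnd2 x y t : convex_hull F x -> convex_hull F y ->
    (forall h k, h <= 1 -> k <= 1 -> h <= x -> h * x <= 1 -> k <= y ->
       k * y <= 1 -> (h * k <= t /\ (h * k * t <= 1 \/ k * h * t <= 1))) ->
    convex_hull F t.
  move=> [h Fh [hx hx1]] [k Fk [ky ky1]] H.
  have h1 := neg_filter_le1 _ Ff _ Fh; have k1 := neg_filter_le1 _ Ff _ Fk.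
  have [hkt hkt1] := H h k h1 k1 hx hx1 ky ky1.
  have Fhk := neg_filterM _ Ff _ _ Fh Fk; have Fkh := neg_filterM _ Ff _ _ Fk Fh.
  have hk1 := neg_filter_le1 _ Ff _ Fhk; have kh1 := neg_filter_le1 _ Ff _ Fkh.
  exists (h * k * (k * h)); first exact: (neg_filterM _ Ff).
  split; first by rewrite (le_trans _ hkt)// mul_le_l.
  case: hkt1; apply: le_trans; apply: (res_lemul2r t).
    exact: mul_le_l.
  exact: mul_le_r.
split.
- exact: sub_convex_hull.
- move=> x y Cx Cy; apply: (bnd2 x y) => // h k h1 k1 hx hx1 ky ky1.
  split; first exact: res_lemul.
  right; rewrite mulgA -(mulgA k) (le_trans _ ky1)// res_lemul2r//.
  exact: mul_le_l.
- move=> x y Cx Cy; apply: (bnd2 x y) => // h k h1 k1 hx hx1 ky ky1.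
  split.
    (* Here [x * h <= 1] by exchange of factors, so [x * h * k <= k <= y]. *)
    by rewrite -ldivP mulgA (le_trans _ ky)// mul_le_r// cyclic_le1.
  right; rewrite -mulgA (le_trans _ ky1)// res_lemul2l//.
  by rewrite (le_trans (res_lemul2r _ _ _ hx))// ldivP.
- move=> x y Cx Cy; apply: (bnd2 x y) => // h k h1 k1 hx hx1 ky ky1.
  split; first by rewrite -rdivP -mulgA (le_trans _ hx)// mul_le_l.
  (* The exchanged product is [rdiv x y * k * h], and [rdiv x y * k <= rdiv x y * y <= x]. *)
  right; rewrite cyclic_le1 mulgA; rewrite cyclic_le1 in hx1.
  rewrite (le_trans _ hx1)// res_lemul2r//.
  by rewrite (le_trans (res_lemul2l _ _ _ ky))// rdivP.
- move=> x y Cx Cy; apply: (bnd2 x y) => // h k h1 k1 hx hx1 ky ky1.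
  split; first by rewrite lexU2// (le_trans (mul_le_l _ _ k1)).
  left; rewrite mul_joinr leUx; apply/andP; split.
    by rewrite (le_trans _ hx1)// res_lemul2r// mul_le_l.
  by rewrite (le_trans _ ky1)// res_lemul2r// mul_le_r.
- move=> x y Cx Cy; apply: (bnd2 x y) => // h k h1 k1 hx hx1 ky ky1.
  split.
    by rewrite lexI (le_trans (mul_le_l _ _ k1))// (le_trans (mul_le_r _ _ h1)).
  by left; rewrite (le_trans _ hx1)// res_lemul// ?mul_le_l// leIl.
- move=> x y z Cx Cz xy yz; apply: (bnd2 x z) => // h k h1 k1 hx hx1 kz kz1.
  split; first by rewrite (le_trans (mul_le_l _ _ k1))// (le_trans hx).
  by left; rewrite (le_trans _ kz1)// res_lemul// mul_le_r.
Qed.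

(** Primeness is applied to the hulls of the filters generated by [absval a] and [absval b]. If [z]
    is in both hulls, [filter_gen_join] puts [absval z], written as a join with itself, in [P]. *)
Lemma prime_convex_absval P a b : prime_convex P ->
  P (absval a `|` absval b) -> P a \/ P b.
Proof.
move=> [CP Pprime] Pab.
pose G c := filter_gen [set absval c].
have neg1 c s : [set absval c] s -> s <= 1 by move=> ->; exact: absval_le1.
have GF c : neg_filter (G c) := neg_filter_gen _ (neg1 c).
have Gc c : G c (absval c) by exact: FilterGenIn.
have CG c : convex_subalgebra (convex_hull (G c)).
  apply: convex_hull_subalgebra => //.
  exact: (neg_filter_up _ (GF c) _ _ (Gc c) (absval_le1 c)).
have Hc c : convex_hull (G c) c by exact: convex_hull_absval.
have [z [az bz]|aP|bP] := Pprime _ _ (CG a) (CG b); last 2 first.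
- by left; exact: aP.
- by right; exact: bP.
apply: convex_subalgebra_absval => //.
rewrite -[absval z]joinxx.
suff [] : [set x | P x /\ x <= 1] (absval z `|` absval z) by [].
apply: (filter_gen_join _ _ _ (convex_sub_filter _ CP) (neg1 a) (neg1 b)).
- by move=> s t -> ->; split=> //; exact: absval_join_le1.
- exact: (absval_convex_hull _ _ (GF a)).
- exact: (absval_convex_hull _ _ (GF b)).
Qed.

Lemma prime_convex_separation J : (forall x y, J x -> J y -> J (x `|` y)) ->
    (forall x, J x -> x <= 1) -> ~ J 1 ->
  exists2 Q : set L, prime_convex Q & forall x, J x -> ~ Q x.
Proof.
move=> JU J1 J1N.
pose R F := neg_filter F /\ forall x, J x -> ~ F x.
have [G GR Gtot|M [[Mf MJ] Mmax]] := @Zorn_bigcup L R.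
  split; last by move=> x Jx [F GF Fx]; exact: ((GR F GF).2 x Jx Fx).
  split=> [x [F GF Fx]|x y [F GF Fx] [E GE Ey]|x y [F GF Fx] xy y1].
  - exact: (neg_filter_le1 _ (GR F GF).1).
  - have [FE|EF] := Gtot F E GF GE.
    + by exists E => //; apply: (neg_filterM _ (GR E GE).1) => //; exact: FE.
    + by exists F => //; apply: (neg_filterM _ (GR F GF).1) => //; exact: EF.
  - by exists F => //; exact: (neg_filter_up _ (GR F GF).1 _ _ Fx).
have extend a : a <= 1 -> ~ M a ->
    exists2 j, J j & filter_gen (M `|` [set a])%classic j.
  move=> a1 Ma; apply: contrapT => JN.
  apply: (Mmax (filter_gen (M `|` [set a])%classic)).
    split; first by move=> x Mx; apply: FilterGenIn; left.
    by move=> sub; apply/Ma/sub; apply: FilterGenIn; right.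
  split; last by move=> x Jx Mx; apply: JN; exists x.
  by apply: neg_filter_gen => s [/(neg_filter_le1 _ Mf)|->].
(* The empty set is a filter, so [M] might be empty. In that case 1 alone generates only 1, and
   maximality would put 1 in [J]. *)
have M1 : M 1.
  apply: contrapT => /[dup] M1 /(extend 1 (lexx _)) [j Jj Mj].
  have Mx1 x : M x -> M 1.
    by move=> Mx; apply: (neg_filter_up _ Mf _ _ Mx) => //; exact: (neg_filter_le1 _ Mf).
  apply: J1N; suff <- : j = 1 by [].
  elim: Mj => [s [/Mx1//|->//]|x y _ -> _ ->|x y _ -> y1 y1']; first exact: mulg1.
  by apply/le_anti/andP.
have Mprime a b : a <= 1 -> b <= 1 -> M (a `|` b) -> M a \/ M b.
  move=> a1 b1 Mab; apply: contrapT => /not_orP[Ma Mb].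
  have [j Jj Mj] := extend a a1 Ma; have [k Jk Mk] := extend b b1 Mb.
  apply: (MJ (j `|` k)); first exact: JU.
  have neg c : c <= 1 -> forall s, (M `|` [set c])%classic s -> s <= 1.
    by move=> c1 s [/(neg_filter_le1 _ Mf)|->].
  (* Every join of generators, except that of [a] and [b], lies above an element of [M]. *)
  apply: (filter_gen_join _ _ _ Mf (neg a a1) (neg b b1)) Mj Mk.
  move=> s t As Bt.
  have st1 : s `|` t <= 1 by rewrite leUx (neg a)// (neg b).
  case: As => [Ms|->] in st1 *.
    by apply: (neg_filter_up _ Mf _ _ Ms) => //; exact: leUl.
  case: Bt => [Mt|->//] in st1 *.
  by apply: (neg_filter_up _ Mf _ _ Mt) => //; exact: leUr.
exists (convex_hull M); last first.
  by move=> x Jx /convex_hull_le1 => /(_ Mf (J1 x Jx)); exact: MJ.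
split; first exact: convex_hull_subalgebra.
move=> X Y CX CY XY; apply: contrapT => /not_orP[].
move=> /existsNP[a /not_implyP[Xa Ma]] /existsNP[b /not_implyP[Yb Mb]].
have inC C c x : convex_subalgebra C -> C c -> absval c <= x -> x <= 1 -> C x.
  move=> CC Cc; apply: (convex_sub_convex CC _ (convex_sub1 CC)).
  exact: convex_sub_absval.
have [||||] := Mprime (absval a) (absval b).
- exact: absval_le1.
- exact: absval_le1.
- apply: convex_hull_le1 => //; last exact: absval_join_le1.
  apply: XY; split.
    by apply: (inC X a) => //; rewrite ?leUl ?absval_join_le1.
  by apply: (inC Y b) => //; rewrite ?leUr ?absval_join_le1.
- by move=> /convex_hull_absval.
- by move=> /convex_hull_absval.
Qed.

Lemma minimal_prime_polar P x : nontrivial L -> minimal_prime_convex P ->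
  P x -> ~ (polar x `<=` P)%classic.
Proof.
move=> [c c1] [Pprime Pmin] Px xP; have CP := Pprime.1.
have [PT|/existsNP[y Py]] := pselect (forall y, P y).
  (* Minimality makes [Q] the whole algebra, although it misses [absval c]. *)
  have [_ _ -> ->|_ ->||Q Qprime QJ] := prime_convex_separation [set absval c].
  - by rewrite /= joinxx.
  - exact: absval_le1.
  - by move=> /esym/absval_eq1.
  - apply: (QJ (absval c)) => //.
    by rewrite (Pmin Q Qprime (fun z _ => PT z)).
pose J := [set z `|` absval x | z in [set z | ~ P z /\ z <= 1]].
have joinx_le1 z : z <= 1 -> z `|` absval x <= 1.
  by move=> z1; rewrite leUx z1 absval_le1.
have absvalN z : ~ P z -> ~ P (absval z) /\ absval z <= 1.
  move=> Pz; split; last exact: absval_le1.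
  by move/(convex_subalgebra_absval _ _ CP).
(* [J] is closed under joins because [P] is prime. It misses 1 because a negative [z] whose join
   with [absval x] is 1 lies in [polar x], hence in [P]. *)
have [_ _ [z [Pz z1] <-] [t [Pt t1] <-]|_ [z [_ z1] <-]|[z [Pz z1] zx]|
      Q Qprime QJ] :=
  prime_convex_separation J.
- exists (z `|` t); last by rewrite joinACA joinxx.
  split; last by rewrite leUx z1.
  rewrite -(absval_id z)// -(absval_id t)//.
  by move=> /(prime_convex_absval _ _ _ Pprime)[].
- exact: joinx_le1.
- by apply/Pz/xP; rewrite /polar /= absval_id.
have QP : (Q `<=` P)%classic.
  move=> z Qz; apply: contrapT => /absvalN Pz.
  apply: (QJ (absval z `|` absval x)); first by exists (absval z).
  apply: (convex_sub_convex Qprime.1 _ (convex_sub1 Qprime.1) (leUl _ _)).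
    exact: convex_sub_absval Qprime.1 Qz.
  exact: absval_join_le1.
(* This element of [J] is in [P], being between [absval x] and 1, so it separates [Q] from [P]. *)
apply: (QJ (absval y `|` absval x)).
  by exists (absval y) => //; exact: absvalN.
rewrite (Pmin Q Qprime QP).
apply: (convex_sub_convex CP _ (convex_sub1 CP) (leUr _ _)).
  exact: convex_sub_absval.
exact: absval_join_le1.
Qed.

(** The two absolute values join to 1, which is in [P], so primeness applies. *)
Lemma prime_polar_sub P x y : prime_convex P -> ~ P x -> polar x y -> P y.
Proof.
move=> Pprime Px yx; have Pyx : P (absval y `|` absval x).
  by rewrite yx; exact: convex_sub1 Pprime.1.
by case: (prime_convex_absval _ _ _ Pprime Pyx).
Qed.

Lemma polar_sym x y : polar x y -> polar y x.
Proof. by rewrite /polar /= joinC. Qed.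

End Cyclic.
End NegativeCone.

Theorem proposition4p10 (d : Order.disp_t) (L : residuatedLatticeType d)
    (L_nontrivial : nontrivial L) (L_cyclic : e_cyclic L)
    (P : set L) (P_prime : prime_convex P) :
  (minimal_prime_convex P <->
     forall x : L, P x -> ~ (polar x `<=` P)) /\
  ((forall x : L, P x -> ~ (polar x `<=` P)) <->
     P = \bigcup_(x in ~` P) polar x).
Proof.
split; split.
- by move=> Pmin x; exact: minimal_prime_polar.
- move=> polarP; split=> // Q Qprime QP; apply/seteqP; split=> // x Px.
  (* Some [y] in [polar x] is outside [P], hence outside [Q]; by symmetry [x] is in [polar y], which
     is contained in [Q]. *)
  have /existsNP[y /not_implyP[xy Py]] := polarP x Px.
  apply: (prime_polar_sub L_cyclic Q y) => //; last exact: polar_sym.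
  by move=> /QP.
- move=> polarP; apply/seteqP; split=> [x Px|x [y Py]].
    have /existsNP[y /not_implyP[xy Py]] := polarP x Px.
    by exists y => //; exact: polar_sym.
  exact: prime_polar_sub.
- move=> PE x; rewrite {1}PE => -[y Py xy] xP.
  by apply/Py/xP/polar_sym.
Qed.
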